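(* Let $T>0$, let $(\mathcal{P}_N)_{N\in\mathbb{N}}$ be a quasi-uniform sequence of partitions of $[0,T]$, and let $f\sim\mathcal{GP}(0,k_{l,H})$ on $[0,T]$ with $l\in\{0,1\}$ and $0<H<1$, where $k_{0,H}$ is the fractional Brownian motion kernel and $k_{1,H}$ the integrated fractional Brownian motion kernel with Hurst parameter $H$. Let $\hat{\sigma}_{\mathrm{CV}}^2$ be the leave-one-out cross-validation estimator of the scale parameter for the Brownian motion kernel computed from the values of $f$ at the points of $\mathcal{P}_N$. Then, as $N\to\infty$, $$\mathbb{E}\,\hat{\sigma}_{\mathrm{CV}}^2=\Theta\big(N^{1-\min\{2(l+H),3\}}\big)=\begin{cases}\Theta(N^{1-2H})&\text{if } l=0 \text{ and } H\in(0,1),\\ \Theta(N^{-1-2H})&\text{if } l=1\text{ and }H<1/2,\\ \Theta(N^{-2})&\text{if } l=1\text{ and }H\ge1/2.\end{cases}$$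
   Context: Partitions: for each $N\in\mathbb{N}$, $\mathcal{P}_N=(x_{N,n})_{n=1}^N\subset[0,T]$ with $0=:x_{N,0}<x_{N,1}<\dots<x_{N,N}=T$; write $x_n$ for $x_{N,n}$. With $\Delta x_{N,n}=x_{N,n+1}-x_{N,n}$, $n=0,\dots,N-1$, the sequence $(\mathcal{P}_N)$ is quasi-uniform if there is a constant $1\le C_{\mathrm{qu}}<\infty$ such that $\sup_{N\in\mathbb{N}}\frac{\max_n\Delta x_{N,n}}{\min_n\Delta x_{N,n}}=C_{\mathrm{qu}}$. $\mathcal{GP}(0,\kappa)$ denotes the Gaussian process with zero mean function and covariance function $\kappa$. For $0<H<1$, $$k_{0,H}(x,x')=\tfrac12\big(|x|^{2H}+|x'|^{2H}-|x-x'|^{2H}\big),\qquad k_{1,H}(x,x')=\int_0^x\int_0^{x'}k_{0,H}(z,z')\,\mathrm{d}z'\,\mathrm{d}z .$$ Cross-validation estimator: let $k(x,x')=\min(x,x')$ on $[0,T]$ (Brownian motion kernel). For $\mathbf{x}=(x_1,\dots,x_N)$ let $\mathbf{x}_{\setminus n}$ be $\mathbf{x}$ with $x_n$ removed, and define the zero-mean Gaussian process posterior mean and variance $$m_{\setminus n}(x)=k(\mathbf{x}_{\setminus n},x)^\top k(\mathbf{x}_{\setminus n},\mathbf{x}_{\setminus n})^{-1}f(\mathbf{x}_{\setminus n}),\qquad k_{\setminus n}(x)=k(x,x)-k(\mathbf{x}_{\setminus n},x)^\top k(\mathbf{x}_{\setminus n},\mathbf{x}_{\setminus n})^{-1}k(\mathbf{x}_{\setminus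 n},x),$$ where $k(\mathbf{x}_{\setminus n},x)$ is the vector of $k(x_i,x)$, $i\ne n$, $k(\mathbf{x}_{\setminus n},\mathbf{x}_{\setminus n})$ is the matrix of $k(x_i,x_j)$, $i,j\neq n$, and $f(\mathbf{x}_{\setminus n})$ is the vector of $f(x_i)$, $i\ne n$. Then $$\hat{\sigma}_{\mathrm{CV}}^2=\frac1N\sum_{n=1}^N\frac{[f(x_n)-m_{\setminus n}(x_n)]^2}{k_{\setminus n}(x_n)}.$$ $a_N=\Theta(b_N)$ means that there are constants $0<c\le C<\infty$ with $c\,b_N\le a_N\le C\,b_N$ for all sufficiently large $N$. *)

(* Defs.v *)
From HB Require Import structures.
From mathcomp Require Import all_boot all_order all_algebra.
From mathcomp Require Import all_classical all_reals all_analysis.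

Set Implicit Arguments.
Unset Strict Implicit.
Unset Printing Implicit Defensive.

Import Order.TTheory GRing.Theory Num.Theory.
Import numFieldNormedType.Exports.

Local Open Scope classical_set_scope.
Local Open Scope ring_scope.

Section Partitions.
Context {R : realType}.

(* A partition of [0, T] with N intervals is given by its points
   x 0 = 0 < x 1 < ... < x N = T; the values of x beyond N are irrelevant. *)
Definition is_partition (T : R) (N : nat) (x : nat -> R) : Prop :=
  [/\ x 0%N = 0, (forall n, (n < N)%N -> x n < x n.+1) & x N = T].

Definition spacing (x : nat -> R) (n : nat) : R := x n.+1 - x n.

(* For N >= 1 the base value [spacing x 0] of the iterated operators is itself
   one of the spacings, so these are the maximum and minimum over n < N. *)
Definition max_spacing (N : nat) (x : nat -> R) : R :=
  \big[Num.max/spacing x 0]_(n < N) spacing x n.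

Definition min_spacing (N : nat) (x : nat -> R) : R :=
  \big[Num.min/spacing x 0]_(n < N) spacing x n.

Definition quasi_uniform (x : nat -> nat -> R) : Prop :=
  exists2 Cqu : R, 1 <= Cqu &
    ereal_sup [set (max_spacing N (x N) / min_spacing N (x N))%:E
              | N in [set N : nat | (0 < N)%N]] = Cqu%:E.

End Partitions.

Section GaussianProcesses.
Context {R : realType}.

(* [normal_prob m 0] is not the Dirac mass at m, hence the case distinction. *)
Definition gaussian_law (m s : R) (A : set R) : \bar R :=
  if s == 0 then \d_m A else normal_prob m s A.

Context {d : measure_display} {Omega : measurableType d}.
Variable P : probability Omega R.

Definition gaussian_variable (Y : Omega -> R) : Prop :=
  exists m s : R, 0 <= s /\
    forall A : set R, measurable A -> pushforward P Y A = gaussian_law m s A.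

(* Every finite-dimensional marginal is a (possibly degenerate) multivariate
   Gaussian: all its linear combinations are Gaussian. *)
Definition gaussian_process (D : set R) (m : R -> R) (k : R -> R -> R)
    (f : R -> {RV P >-> R}) : Prop :=
  [/\ (forall (n : nat) (t a : 'I_n -> R), (forall i, D (t i)) ->
        gaussian_variable (fun w => \sum_(i < n) a i * f (t i) w)),
      (forall t, D t -> ('E_P[f t] = (m t)%:E)%E)
    & (forall s t, D s -> D t -> covariance P (f s) (f t) = (k s t)%:E)].

End GaussianProcesses.

Section Kernels.
Context {R : realType}.

Definition brownian_kernel (x x' : R) : R := Num.min x x'.

Definition fbm_kernel (H x x' : R) : R :=
  (`|x| `^ (2 * H) + `|x'| `^ (2 * H) - `|x - x'| `^ (2 * H)) / 2.

(* Meaningful for x, x' >= 0 only: no sign convention for reversed bounds. *)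
Definition integrated_kernel (k : R -> R -> R) (x x' : R) : R :=
  \int[lebesgue_measure]_(z in `[0, x])
    (\int[lebesgue_measure]_(z' in `[0, x']) k z z').

(* l = 0: fractional Brownian motion; l = 1: integrated fractional Brownian
   motion. *)
Definition ifbm_kernel (l : nat) (H : R) : R -> R -> R :=
  iter l integrated_kernel (fbm_kernel H).

End Kernels.

Section CrossValidation.
Context {R : realType}.
Variable k : R -> R -> R.

Definition kernel_mx (m : nat) (x : 'I_m -> R) : 'M[R]_m :=
  \matrix_(i, j) k (x i) (x j).

Definition kernel_col (m : nat) (x : 'I_m -> R) (t : R) : 'cV[R]_m :=
  \col_i k (x i) t.

Definition posterior_mean (m : nat) (x : 'I_m -> R) (f : R -> R) (t : R) : R :=
  ((kernel_col x t)^T *m invmx (kernel_mx x) *m (\col_i f (x i))) 0 0.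

Definition posterior_var (m : nat) (x : 'I_m -> R) (t : R) : R :=
  k t t - ((kernel_col x t)^T *m invmx (kernel_mx x) *m kernel_col x t) 0 0.

Definition leave_out (N : nat) (x : 'I_N -> R) (n : 'I_N) : 'I_N.-1 -> R :=
  fun i => x (lift n i).

Definition cv_estimator (N : nat) (x : 'I_N -> R) (f : R -> R) : R :=
  N%:R^-1 * \sum_(n < N)
    (f (x n) - posterior_mean (leave_out x n) f (x n)) ^+ 2
      / posterior_var (leave_out x n) (x n).

End CrossValidation.

Section Asymptotics.
Context {R : realType}.
Local Open Scope ereal_scope.

(* The left-hand sequence is extended-real-valued, as expectations are. *)
Definition is_Theta (a : nat -> \bar R) (b : nat -> R) : Prop :=
  exists c C : R, [/\ (0 < c)%R, (c <= C)%R &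
    \forall N \near \oo, (c * b N)%:E <= a N /\ a N <= (C * b N)%:E].

End Asymptotics.

(* Main.v *)
Require Import Defs.
From HB Require Import structures.
From mathcomp Require Import all_boot all_order all_algebra.
From mathcomp Require Import all_classical all_reals all_analysis.
From mathcomp Require Import measurable_realfun ring lra zify.
Import Order.TTheory GRing.Theory Num.Theory.
Import numFieldNormedType.Exports.
Local Open Scope classical_set_scope.
Local Open Scope ring_scope.

(* The Brownian posterior mean at a left-out point x_n is the linear
   interpolation between its two neighbours (with f(0) read as 0), and the value
   at x_{N-1} when n = N.  Hence the expected estimator is a deterministic
   quadratic form in the covariance kernel of f.  With spacings a and b on both
   sides of x_n, everything but the powers of |x - x'| cancels in this quadratic
   form, and the n-th interior term equals
     a^(2H-1) + b^(2H-1) - (a+b)^(2H-1)                            for l = 0,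
     ((a+b)^(2H+1) - a^(2H+1) - b^(2H+1)) / ((2H+1)(2H+2))         for l = 1,
   that is Theta(N^-(2(l+H)-1)) by quasi-uniformity.  The boundary term n = N is
   of the same order when l = 0, but Theta(N^-1) when l = 1, since f' does not
   vanish at T; it is the boundary term that saturates the rate at N^-2. *)

(** * Prediction with the Brownian kernel *)

Section MinKernel.
Context {R : realType}.

Lemma brownian_kernel_mx_unit (m : nat) (x : 'I_m -> R) :
  (forall i, 0 < x i) -> (forall i j : 'I_m, (i < j)%N -> x i < x j) ->
  kernel_mx brownian_kernel x \in unitmx.
Proof.
move=> x_gt0 x_lt.
have x_le (i j : 'I_m) : (i <= j)%N -> x i <= x j.
  by rewrite leq_eqVlt => /orP[/eqP/val_inj->//|/x_lt/ltW].
(* [Y] is [x] shifted by one index and preceded by 0, so that the first increment is [x] at index 0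
   itself. *)
pose Y (k : nat) : R := if k is k'.+1 then oapp x 0 (insub k') else 0.
have YS (i : 'I_m) : Y i.+1 = x i by rewrite /Y valK.
(* [K = L D L^T], with [L] unitriangular and [D] the diagonal of increments. *)
pose L : 'M[R]_m := \matrix_(i, j) (j <= i)%N%:R.
pose D : 'rV[R]_m := \row_j (Y j.+1 - Y j).
have -> : kernel_mx brownian_kernel x = L *m diag_mx D *m L^T.
  apply/matrixP => i j; rewrite !mxE.
  under eq_bigr => k _ do rewrite mul_mx_diag !mxE mulrAC -natrM mulnb.
  (* Rows [i] and [j] of [L] overlap on the indices up to [minn i j]; the increments up to there
     telescope to the smaller of [x i] and [x j]. *)
  transitivity (\sum_(0 <= k < m | true && (k < (minn i j).+1)%N) (Y k.+1 - Y k)).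
    rewrite -big_nat_widen; last by rewrite gtn_min ltn_ord.
    rewrite telescope_sumr// [Y 0%N]/= subr0 /brownian_kernel.
    have [ij|/ltnW ji] := leqP i j.
      by rewrite YS; apply/min_idPl/x_le.
    by rewrite YS; apply/min_idPr/x_le.
  rewrite big_mkord [LHS]big_mkcond/=; apply: eq_bigr => k _.
  by rewrite ltnS leq_min; case: ifP => _; rewrite ?mul1r ?mul0r.
have detL : \det L = 1.
  rewrite det_trig; last first.
    by apply/is_trig_mxP => i j ij; rewrite mxE leqNgt ij.
  by apply: big1 => i _; rewrite mxE leqnn.
rewrite unitmxE !det_mulmx det_tr detL mul1r mulr1 det_diag unitfE.
apply/prodf_neq0 => -[i im] _; rewrite mxE/= subr_eq0 gt_eqF//.
have /= -> := YS (Ordinal im).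
case: i im => [im|i im]; first exact: x_gt0.
by have /= -> := YS (Ordinal (ltnW im)); exact: x_lt.
Qed.

(** As the kernel matrix is invertible, any solution of the linear system for the weights is the row
    that defines the posterior. Weights can thus be guessed and checked, without computing an
    inverse. *)
Lemma posterior_weights (m : nat) (k : R -> R -> R) (x w : 'I_m -> R) (t : R) :
  kernel_mx k x \in unitmx ->
  (forall j, \sum_i w i * k (x i) (x j) = k (x j) t) ->
  (forall f, posterior_mean k x f t = \sum_i w i * f (x i)) /\
  posterior_var k x t = k t t - \sum_i w i * k (x i) t.
Proof.
move=> Ku wk.
have wK : (kernel_col k x t)^T *m invmx (kernel_mx k x) = \row_i w i.
  apply: (can_inj (mulmxK Ku)); rewrite mulmxKV//.
  apply/rowP => j; rewrite !mxE -wk.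
  by apply: eq_bigr => i _; rewrite !mxE.
split=> [f|]; rewrite /posterior_mean /posterior_var wK !mxE; [|congr (_ - _)];
  by apply: eq_bigr => i _; rewrite !mxE.
Qed.

Lemma partition_lt (T : R) (N : nat) (y : nat -> R) : is_partition T N y ->
  forall i j, (i < j <= N)%N -> y i < y j.
Proof.
move=> [_ yS _] i j /andP[]; elim: j => // j IHj.
rewrite ltnS leq_eqVlt => /orP[/eqP->|ij] jN; first exact: yS.
exact: lt_trans (IHj ij (ltnW jN)) (yS _ jN).
Qed.

(* [be = 0] covers the last design point, which has no right neighbour: there
   [y n.+2] is a junk value. *)
Lemma leave_out_weights (T : R) (N : nat) (y : nat -> R) (n : 'I_N) (al be : R) :
  is_partition T N y -> (n.+2 <= N)%N || (be == 0) -> al + be = 1 ->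
  y n.+1 = al * y n + be * y n.+2 \/ be = 0 /\ n.+1 = N ->
  let x := fun i : 'I_N => y i.+1 in
  (forall F, F 0 = 0 ->
     posterior_mean brownian_kernel (leave_out x n) F (x n) =
     al * F (y n) + be * F (y n.+2)) /\
  posterior_var brownian_kernel (leave_out x n) (x n) = al * (y n.+1 - y n).
Proof.
move=> yP n2 albe yw x; have [y0 yS yN] := yP.
have ylt := partition_lt _ _ _ yP.
have yle i j : (i <= j <= N)%N -> y i <= y j.
  by move=> /andP[]; rewrite leq_eqVlt => /orP[/eqP->//|ij jN]; rewrite ltW ?ylt ?ij.
(* The guessed weights, indexed by partition points: the left-out point is [y n.+1], its neighbours
   are [y n] and [y n.+2]. Index 0 is not a design point, which is harmless for functions vanishing
   there. *)
pose W (k : nat) : R := (k == n)%:R * al + (k == n.+2)%:R * be.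
have sumW G : G 0%N = 0 ->
    \sum_(i < N.-1) W (lift n i).+1 * G (lift n i).+1 = al * G n + be * G n.+2.
  move=> G0.
  have -> : \sum_(i < N.-1) W (lift n i).+1 * G (lift n i).+1 =
            \sum_(i < N) W i.+1 * G i.+1.
    rewrite [RHS](bigD1_ord n)//= [X in _ = X + _](_ : _ = 0) ?add0r//.
    by rewrite /W gtn_eqF// ltn_eqF// !mul0r addr0 mul0r.
  have -> : \sum_(i < N) W i.+1 * G i.+1 = \sum_(i < N.+1) W i * G i.
    by rewrite [RHS]big_ord_recl/= G0 mulr0 add0r.
  rewrite /W; under eq_bigr => i _ do rewrite mulrDl -!mulrA.
  rewrite big_split/=; congr (_ + _).
    have nN : (n < N.+1)%N by rewrite ltnS ltnW.
    rewrite (bigD1 (Ordinal nN))//= eqxx mul1r big1 ?addr0// => i.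
    by rewrite -val_eqE/= => /negbTE->; rewrite mul0r.
  case/orP: n2 => [nN|/eqP->]; last first.
    by rewrite mul0r; apply: big1 => i _; rewrite mul0r mulr0.
  have nN' : (n.+2 < N.+1)%N by [].
  rewrite (bigD1 (Ordinal nN'))//= eqxx mul1r big1 ?addr0// => i.
  by rewrite -val_eqE/= => /negbTE->; rewrite mul0r.
have y_gt0 (i : 'I_N) : 0 < y i.+1 by rewrite -y0 ylt// ltn0Sn/=.
have Ku : kernel_mx brownian_kernel (leave_out x n) \in unitmx.
  apply: brownian_kernel_mx_unit => [i|i j ij]; first exact: y_gt0.
  apply: ylt; rewrite !ltnS (ltn_ord (lift n j)) andbT /= /bump.
  by case: leqP; case: leqP; lia.
have [|pm pv] := posterior_weights _ _ _ (fun i => W (lift n i).+1) (x n) Ku.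
  move=> j; set u := lift n j.
  rewrite (sumW (fun k => brownian_kernel (y k) (y u.+1))); last first.
    by rewrite /brownian_kernel y0 min_l// ltW.
  rewrite /brownian_kernel/leave_out/x -/u.
  have : (u != n :> nat) by rewrite eq_sym neq_lift.
  (* At a design point left of the gap all minima with a nonzero weight are [y u.+1], and
     [al + be = 1] suffices. Right of it the minima are [y n], [y n.+2] and [y n.+1], and the
     equation is the interpolation identity [yw]. *)
  rewrite neq_ltn => /orP[un|nu].
    rewrite [RHS]min_l; last by rewrite yle// !ltnS ltnW/=.
    rewrite min_r; last by rewrite yle// un/= ltnW.
    case/orP: n2 => [nN|/eqP be0]; last first.
      by rewrite be0 mul0r addr0 -(addr0 al) -be0 albe mul1r.
    rewrite min_r; last by rewrite yle// nN andbT; lia.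
    by rewrite -mulrDl albe mul1r.
  have nN : (n.+2 <= N)%N by exact: leq_ltn_trans nu (ltn_ord u).
  rewrite [RHS]min_r; last by rewrite yle// ltn_ord andbT; lia.
  rewrite min_l; last by rewrite yle// ltn_ord andbT; lia.
  rewrite min_l; last by rewrite yle// ltn_ord andbT; lia.
  by case: yw => [->//|[_ nE]]; move: nN; rewrite [X in (_ <= X)%N](esym nE) ltnn.
split=> [F F0|]; first by rewrite pm (sumW (fun k => F (y k)))// y0.
rewrite pv (sumW (fun k => brownian_kernel (y k) (x n))); last first.
  by rewrite /brownian_kernel y0 min_l// ltW ?y_gt0.
rewrite /brownian_kernel/x minxx min_l; last by rewrite ltW// yS.
case/orP: n2 => [nN|/eqP be0].
  rewrite min_r; last by rewrite ltW// yS.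
  by rewrite -[X in X - _]mul1r -albe; ring.
by rewrite be0 mul0r addr0 -[X in X - _]mul1r -albe be0; ring.
Qed.

(** For the first design point the left neighbour is the origin, where no value is observed;
    interpolation through 0 there is expressed by [F 0 = 0]. The last point is predicted from its
    left neighbour alone, with weights 1 and 0. *)
Lemma cv_estimator_brownian (T : R) (M : nat) (y : nat -> R) (F : R -> R) :
  is_partition T M.+1 y -> F 0 = 0 ->
  cv_estimator brownian_kernel (fun n : 'I_M.+1 => y n.+1) F =
  M.+1%:R^-1 *
  (\sum_(n < M)
     (F (y n.+1) - (spacing y n.+1 / (y n.+2 - y n) * F (y n)
                    + spacing y n / (y n.+2 - y n) * F (y n.+2))) ^+ 2
       / (spacing y n.+1 / (y n.+2 - y n) * spacing y n)
   + (F (y M.+1) - F (y M)) ^+ 2 / spacing y M).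
Proof.
move=> yP F0; have ylt := partition_lt _ _ _ yP.
rewrite /cv_estimator big_ord_recr/=; congr (_ * (_ + _)).
- apply: eq_bigr => n _.
  set al := spacing y n.+1 / _; set be := spacing y n / _.
  have y02 : y n.+2 - y n != 0.
    by rewrite subr_eq0 gt_eqF// ylt// (leqnSn n.+1)/= ltnS.
  have [] := leave_out_weights T _ y (widen_ord (leqnSn M) n) al be yP.
  + by rewrite /= !ltnS ltn_ord.
  + by rewrite /al /be /spacing; field.
  + by left; rewrite /al /be /spacing /=; field.
  by move=> /(_ F F0)-> ->.
- have [] := leave_out_weights T _ y (@ord_max M) 1 0 yP.
  + by rewrite eqxx orbT.
  + by rewrite addr0.
  + by right.
  by move=> /(_ F F0)-> ->; rewrite !mul1r mul0r addr0.
Qed.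

End MinKernel.

(** * Calculus of powers of the absolute value *)

Section AbsPower.
Context {R : realType}.
Variable q : R.
Hypothesis q_gt0 : 0 < q.

Lemma continuous_abs_powR : continuous (fun u : R => `|u| `^ q).
Proof.
move=> u; have [->|u0] := eqVneq u 0.
  apply/cvgrPdist_lt => e e0; rewrite normr0 powR0 ?gt_eqF//.
  (* At 0 the modulus of continuity is explicit: [|t| < e ^ (1/q)] gives [|t| ^ q < e]. *)
  have e'0 : 0 < e `^ q^-1 by exact: powR_gt0.
  near=> t; have te : `|t| < e `^ q^-1.
    near: t.
    by exists (e `^ q^-1) => // v; rewrite /ball_/= sub0r normrN.
  rewrite sub0r normrN ger0_norm ?powR_ge0//.
  rewrite -[ltRHS](powRr1 (ltW e0)) -(mulVf (lt0r_neq0 q_gt0)) powRrM.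
  by rewrite gt0_ltr_powR// nnegrE ?powR_ge0.
have cq : {for `|u|, continuous (fun t : R => t `^ q)}.
  apply/differentiable_continuous/derivable1_diffP.
  by apply: derivable_powR; rewrite in_itv/= andbT normr_gt0.
exact: (cvg_comp _ _ (@norm_continuous _ R u) cq).
Unshelve. all: by end_near. Qed.

(** The odd extension of the power gives a primitive of [|u| ^ q] valid across 0, so integrals over
    intervals containing the singular point need no splitting. *)
Lemma is_derive_signed_powR (u : R) :
  is_derive u 1 (fun u => u * `|u| `^ q) ((q + 1) * `|u| `^ q).
Proof.
have pos (v : R) : 0 < v -> is_derive v 1 (fun u => u `^ (q + 1)) ((q + 1) * v `^ q).
  by move=> v0; have := is_derive1_powR (q + 1) v0; rewrite addrK.
have [u0|u0|->] := ltgtP u 0.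
- apply: (@near_eq_is_derive _ _ _ (fun v => - ((- v) `^ (q + 1)))).
    near=> v; have v0 : v < 0 by near: v; exact: lt_nbhsl.
    rewrite ltr0_norm// -(@mulr_powRB1 _ (- v) (q + 1)) ?oppr_ge0 ?(ltW v0)//; last first.
      by rewrite addr_gt0.
    by rewrite addrK mulNr opprK.
  have nu0 : 0 < - u by lra.
  have h := pos _ nu0.
  have h2 := @is_derive1_comp _ (fun u => u `^ (q + 1)) -%R u _ _ h (is_deriveNid u 1).
  apply: is_derive_eq.
  by rewrite ltr0_norm//; ring.
- apply: (@near_eq_is_derive _ _ _ (fun v => v `^ (q + 1))).
    near=> v; have v0 : 0 < v by near: v; exact: lt_nbhsr.
    rewrite gtr0_norm// -(@mulr_powRB1 _ v (q + 1)) ?(ltW v0)//; last by rewrite addr_gt0.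
    by rewrite addrK.
  by rewrite gtr0_norm//; exact: pos.
- rewrite normr0 powR0 ?gt_eqF// mulr0.
  (* At 0 the difference quotient is [|h| ^ q] itself. *)
  have c : h^-1 *: ((fun u => u * `|u| `^ q) (h *: 1 + 0) - 0 * `|0 : R| `^ q)
      @[h --> 0^'] --> (0:R).
    have : `|h| `^ q @[h --> (0:R)^'] --> (0:R).
      have h : `|v| `^ q @[v --> (0:R)] --> `|0 : R| `^ q.
        exact: continuous_abs_powR.
      rewrite normr0 powR0 ?gt_eqF// in h.
      by apply: cvg_trans h; apply: cvg_app; exact: cvg_within.
    move=> lim0; apply: cvg_trans lim0; apply: near_eq_cvg; near=> h.
    have h0 : h != 0 by near: h; exact: nbhs_dnbhs_neq.
    by rewrite mul0r subr0 addr0 /GRing.scale/= mulr1 mulrA mulVf// mul1r.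
  by split; [apply/cvg_ex; exists 0 | exact/cvg_lim].
Unshelve. all: by end_near. Qed.

(** Serves as the second primitive, for the outer integral. Written as a product, it follows from
    the product rule without separating signs. *)
Lemma is_derive_abs_powR2 (u : R) :
  is_derive u 1 (fun u => u * (u * `|u| `^ q)) ((q + 2) * (u * `|u| `^ q)).
Proof.
refine (is_derive_eq (@is_deriveM _ _ id (fun u => u * `|u| `^ q) u 1 _ _
            (is_derive_id u 1) (is_derive_signed_powR u)) _).
by rewrite /GRing.scale/=; ring.
Qed.

(** The fundamental theorem of calculus, including [a = b], since the integrated kernel is also
    evaluated at the origin. *)
Lemma Rintegral_derive (F f : R -> R) (a b : R) : a <= b ->
  (forall u : R, is_derive u 1 F (f u)) -> continuous f ->
  \int[lebesgue_measure]_(u in `[a, b]) f u = F b - F a.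
Proof.
move=> ab dF cf; move: ab; rewrite le_eqVlt => /orP[/eqP->|ab].
  by rewrite set_itv1 Rintegral_set1 subrr.
have cF : continuous F.
  move=> u; apply/differentiable_continuous/derivable1_diffP.
  by have [] := dF u.
rewrite /Rintegral (continuous_FTC2 ab _ _ _ (F := F))//.
- exact: continuous_subspaceT.
- split=> [u _||].
  + by have [] := dF u.
  + exact/cvg_at_right_filter/cF.
  + exact/cvg_at_left_filter/cF.
- by move=> u _; rewrite derive1E; have [] := dF u.
Qed.

End AbsPower.

(** * Closed form of the integrated fractional Brownian kernel *)

Section IntegratedFbm.
Context {R : realType}.

Lemma integrated_fbm_kernelE (H s t : R) : 0 < H -> 0 <= s -> 0 <= t ->
  let q := 2 * H in
  integrated_kernel (fbm_kernel H) s t =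
    (t * s `^ (q + 1) / (q + 1) + s * t `^ (q + 1) / (q + 1)
     - (s `^ (q + 2) + t `^ (q + 2) - `|s - t| `^ (q + 2))
         / ((q + 1) * (q + 2))) / 2.
Proof.
move=> H0 s0 t0 q; have q0 : 0 < q by rewrite mulr_gt0.
pose psi (u : R) := u * `|u| `^ q.
have cabs : continuous (fun u : R => `|u| `^ q) := continuous_abs_powR q q0.
have dpsi := is_derive_signed_powR q q0; rewrite -/psi in dpsi.
have dpsi2 := is_derive_abs_powR2 q q0.
have cpsi : continuous psi.
  move=> u; apply/differentiable_continuous/derivable1_diffP.
  by have [] := dpsi u.
have q1 : q + 1 != 0 by rewrite gt_eqF; lra.
have q2 : q + 2 != 0 by rewrite gt_eqF; lra.
have inner z : \int[lebesgue_measure]_(z' in `[0, t]) fbm_kernel H z z' =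
    (`|z| `^ q * t + (psi t - psi (t - z) - psi z) / (q + 1)) / 2.
  pose G (u : R) := (`|z| `^ q * u + (psi u - psi (u - z)) / (q + 1)) / 2.
  have dG (u : R) : is_derive u 1 G (fbm_kernel H z u).
    have dz := @is_derive1_comp _ psi (fun u => u - z) u _ _ (dpsi (u - z))
      (is_deriveB (is_derive_id u 1) (is_derive_cst z u 1)).
    refine (is_derive_eq (is_deriveM (is_deriveD (is_deriveM (is_derive_cst (_ : R) _ _)
        (is_derive_id u 1)) (is_deriveM (is_deriveB (dpsi u) dz)
        (is_derive_cst (_ : R) _ _))) (is_derive_cst (2^-1 : R) u 1)) _).
    rewrite /GRing.scale/= -[GRing.NzRing_hasMulInverse.inv _ _]/((q + 1)^-1).
    by rewrite /fbm_kernel -/q (distrC z u) !mulr0; field.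
  rewrite (Rintegral_derive G)//.
    by rewrite /G /psi sub0r normrN; field.
  move=> u; rewrite /fbm_kernel -/q.
  apply: cvgM; last exact: cvg_cst.
  apply: cvgB.
    by apply: cvgD; [exact: cvg_cst|exact: cabs].
  apply: (@continuous_comp _ _ _ (fun u => z - u) (fun u => `|u| `^ q)).
    by apply: cvgB; [exact: cvg_cst|exact: cvg_id].
  exact: cabs.
rewrite /integrated_kernel; under eq_Rintegral => z _ do rewrite inner.
(* [v * psi v] has derivative [(q + 2) * psi v], so its multiples integrate the terms in
   [psi (t - z)] and [psi z]. *)
pose G (z : R) := (psi z * t / (q + 1) + (psi t * z
  + ((t - z) * psi (t - z) - z * psi z) / (q + 2)) / (q + 1)) / 2.
have dG (u : R) : is_derive u 1 G
    ((`|u| `^ q * t + (psi t - psi (t - u) - psi u) / (q + 1)) / 2).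
  have dz := @is_derive1_comp _ (fun u => u * psi u) (fun u => t - u) u _ _
    (dpsi2 (t - u)) (is_deriveB (is_derive_cst t u 1) (is_derive_id u 1)).
  refine (is_derive_eq (is_deriveM (is_deriveD
      (is_deriveM (is_deriveM (dpsi u) (is_derive_cst (_ : R) _ _)) (is_derive_cst (_ : R) _ _))
      (is_deriveM (is_deriveD (is_deriveM (is_derive_cst (psi t) u 1) (is_derive_id u 1))
         (is_deriveM (is_deriveB dz (dpsi2 u)) (is_derive_cst ((q + 2)^-1 : R) u 1)))
         (is_derive_cst ((q + 1)^-1 : R) u 1))) (is_derive_cst (2^-1 : R) u 1)) _).
  rewrite /GRing.scale/= -/(psi u) -/(psi (t - u)) !mulr0.
  rewrite -[GRing.NzRing_hasMulInverse.inv _ _]/((q + 1)^-1).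
  by field; rewrite q1 q2.
rewrite (Rintegral_derive G)//; last first.
  move=> u; apply: cvgM; last exact: cvg_cst.
  apply: cvgD; first by apply: cvgM; [exact: cabs|exact: cvg_cst].
  apply: cvgM; last exact: cvg_cst.
  apply: cvgB; last exact: cpsi.
  apply: cvgB; first exact: cvg_cst.
  apply: (@continuous_comp _ _ _ (fun u => t - u) psi); last exact: cpsi.
  by apply: cvgB; [exact: cvg_cst|exact: cvg_id].
(* Every power is reduced to [psi], after which the claim is a rational identity. *)
have pw1 v : 0 <= v -> v `^ (q + 1) = psi v.
  move=> v0; rewrite -(@mulr_powRB1 _ v (q + 1)) ?addrK//; last by lra.
  by rewrite /psi ger0_norm.
have pw2 (v : R) : `|v| `^ (q + 2) = v * psi v.
  rewrite -(@mulr_powRB1 _ `|v| (q + 2))//; last by lra.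
  have -> : q + 2 - 1 = q + 1 by ring.
  by rewrite pw1// /psi normr_id mulrA -expr2 real_normK ?num_real// expr2 -mulrA.
have pw2' v : 0 <= v -> v `^ (q + 2) = v * psi v.
  by move=> v0; rewrite -pw2 ger0_norm.
rewrite (pw1 s s0) (pw1 t t0) (pw2' s s0) (pw2' t t0) pw2 /G !subr0.
rewrite (_ : (s - t) * psi (s - t) = (t - s) * psi (t - s)); last first.
  by rewrite /psi distrC; ring.
have -> : psi 0 = 0 by rewrite /psi mul0r.
by field; rewrite q1 q2.
Qed.

End IntegratedFbm.

(** * Means of products and of squared linear combinations *)

Section HasMean.
Context {R : realType} {d : measure_display} {Omega : measurableType d}.
Variable P : probability Omega R.

(** Additivity of the expectation requires integrability, so the two are carried together and means
    can be computed compositionally. *)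
Definition has_mean (Y : Omega -> R) (m : R) : Prop :=
  P.-integrable setT (EFin \o Y) /\ 'E_P[Y]%E = m%:E.

Lemma has_mean_eq (Y Z : Omega -> R) (m m' : R) :
  has_mean Y m -> Y =1 Z -> m = m' -> has_mean Z m'.
Proof. by move=> YP /funext<- <-. Qed.

Lemma has_mean0 : has_mean (fun=> 0) 0.
Proof.
by split; [exact: integrable0|rewrite (expectation_cst P 0)].
Qed.

Lemma has_meanD (Y Z : Omega -> R) (m m' : R) :
  has_mean Y m -> has_mean Z m' -> has_mean (fun w => Y w + Z w) (m + m').
Proof.
move=> [iY EY] [iZ EZ]; split; first exact: (integrableD measurableT iY iZ).
by rewrite (expectationD (X := Y) (Y := Z)) ?EY ?EZ//; exact/Lfun1_integrable.
Qed.

Lemma has_meanZ (c : R) (Y : Omega -> R) (m : R) :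
  has_mean Y m -> has_mean (fun w => c * Y w) (c * m).
Proof.
move=> [iY EY]; split; first exact: (integrableZl measurableT c iY).
rewrite (_ : (fun w => _) = c \o* Y); last by apply/funext => w /=; rewrite mulrC.
by rewrite expectationZl ?EY//; exact/Lfun1_integrable.
Qed.

Lemma has_mean_sum (n : nat) (Y : 'I_n -> Omega -> R) (m : 'I_n -> R) :
  (forall i, has_mean (Y i) (m i)) ->
  has_mean (fun w => \sum_(i < n) Y i w) (\sum_(i < n) m i).
Proof.
elim: n Y m => [|n IHn] Y m Ym.
  by apply: (has_mean_eq _ _ _ _ has_mean0) => [w|]; rewrite big_ord0.
rewrite big_ord_recr; under eq_fun do rewrite big_ord_recr.
by apply: has_meanD => //; apply: (IHn (fun i => Y (widen_ord (leqnSn n) i))).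
Qed.

(** A square is integrable as soon as its mean is finite, and the product is dominated by
    [X^2 + Y^2]. *)
Lemma has_mean_mul (X Y : {RV P >-> R}) (mx my m : R) :
  'E_P[fun w => (X w * X w)%R]%E = mx%:E -> 'E_P[fun w => (Y w * Y w)%R]%E = my%:E ->
  'E_P[fun w => (X w * Y w)%R]%E = m%:E -> has_mean (fun w => X w * Y w) m.
Proof.
have sq (Z : {RV P >-> R}) mz : 'E_P[fun w => (Z w * Z w)%R]%E = mz%:E ->
    P.-integrable setT (EFin \o (fun w => Z w * Z w)).
  rewrite unlock => EZ; apply/integrableP; split.
    by apply/measurable_EFinP; apply: measurable_funM.
  rewrite (eq_integral (fun w => (Z w * Z w)%:E)) ?EZ ?ltry// => w _.
  by rewrite gee0_abs// lee_fin -expr2 sqr_ge0.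
move=> /sq iX /sq iY EXY; split=> //.
apply: (@le_integrable _ _ _ P _ measurableT _
  (EFin \o (fun w => X w * X w + Y w * Y w))).
- by apply/measurable_EFinP; apply: measurable_funM.
- move=> w _; rewrite lee_fin [leRHS]ger0_norm; last by rewrite addr_ge0 -?expr2 ?sqr_ge0.
  rewrite ler_norml; have := sqr_ge0 (X w - Y w); have := sqr_ge0 (X w + Y w).
  have := sqr_ge0 (X w); have := sqr_ge0 (Y w).
  by rewrite !expr2 => *; apply/andP; split; lra.
- exact: (integrableD measurableT iX iY).
Qed.

(** Expansion of the square. When the second moments are values of a kernel, the mean is the
    [contrast] of that kernel defined below. *)
Lemma has_mean_sqr_contrast (X Y Z : Omega -> R) (al be xx yy zz xy xz yz : R) :
  has_mean (fun w => X w * X w) xx -> has_mean (fun w => Y w * Y w) yy ->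
  has_mean (fun w => Z w * Z w) zz -> has_mean (fun w => X w * Y w) xy ->
  has_mean (fun w => X w * Z w) xz -> has_mean (fun w => Y w * Z w) yz ->
  has_mean (fun w => (Y w - (al * X w + be * Z w)) ^+ 2)
    (yy + al ^+ 2 * xx + be ^+ 2 * zz - 2 * al * xy - 2 * be * yz
     + 2 * al * be * xz).
Proof.
move=> hxx hyy hzz hxy hxz hyz.
apply: (has_mean_eq _ _ _ _
  (has_meanD _ _ _ _ (has_meanD _ _ _ _ (has_meanD _ _ _ _ (has_meanD _ _ _ _
    (has_meanD _ _ _ _ hyy (has_meanZ (al ^+ 2) _ _ hxx))
    (has_meanZ (be ^+ 2) _ _ hzz)) (has_meanZ (- (2 * al)) _ _ hxy))
    (has_meanZ (- (2 * be)) _ _ hyz)) (has_meanZ (2 * al * be) _ _ hxz))) => [w|];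
  by ring.
Qed.

(** For a centred process the covariance is the second moment; being a real number, it also yields
    integrability. *)
Lemma gaussian_process_has_mean (D : set R) (k : R -> R -> R)
    (f : R -> {RV P >-> R}) (s t : R) :
  gaussian_process D (fun=> 0) k f -> D s -> D t ->
  has_mean (fun w => f s w * f t w) (k s t).
Proof.
move=> [_ mf kf] Ds Dt.
have cov u v : D u -> D v -> 'E_P[fun w => (f u w * f v w)%R]%E = (k u v)%:E.
  move=> Du Dv; rewrite -kf// covariance.unlock !mf//=; congr (expectation P _).
  by apply/funext => w; rewrite !fctE/= !subr0.
exact: has_mean_mul (cov _ _ Ds Ds) (cov _ _ Dt Dt) (cov _ _ Ds Dt).
Qed.

End HasMean.

(** * Elementary inequalities for real powers *)

Section PowerBounds.
Context {R : realType}.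
Implicit Types (a b e p r x y A B T : R).

Lemma ler_powR_neg r x y : r <= 0 -> 0 < x -> x <= y -> y `^ r <= x `^ r.
Proof.
move=> r0 x0 xy; rewrite -(opprK r) !(powRN _ (- r)) lef_pV2.
- apply: ge0_ler_powR; rewrite ?nnegrE ?oppr_ge0 ?(ltW x0)//.
  exact: le_trans (ltW x0) xy.
- by rewrite posrE powR_gt0// (lt_le_trans x0).
- by rewrite posrE powR_gt0.
Qed.

Lemma powR_split p x : 0 < x -> x `^ p = x * x `^ (p - 1).
Proof.
move=> x0; rewrite -{2}(powRr1 (ltW x0)) -powRD; first by rewrite addrCA subrr addr0.
by rewrite (gt_eqF x0) implybT.
Qed.

(** [A ^ r + B ^ r] dominates [x ^ r] whatever the sign of [r]; taking [r = - p] and inverting gives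
    the lower constant. *)
Lemma powR_bounds A B p : 0 < A -> A <= B ->
  exists c C : R, [/\ 0 < c, 0 < C & forall x, A <= x <= B -> c <= x `^ p <= C].
Proof.
move=> A0 AB; have B0 := lt_le_trans A0 AB.
have ub r x : A <= x <= B -> x `^ r <= A `^ r + B `^ r.
  move=> /andP[Ax xB]; have x0 := lt_le_trans A0 Ax.
  have [r0|/ltW r0] := leP 0 r.
    by rewrite ler_wpDl ?powR_ge0// ge0_ler_powR ?nnegrE ?(ltW x0) ?(ltW B0).
  by rewrite ler_wpDr ?powR_ge0// ler_powR_neg.
exists (A `^ (- p) + B `^ (- p))^-1, (A `^ p + B `^ p).
split=> [||x xAB]; rewrite ?invr_gt0 ?addr_gt0 ?powR_gt0//.
rewrite ub// andbT -[leRHS]invrK -powRN lef_pV2 ?posrE ?ub//.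
  by rewrite addr_gt0 ?powR_gt0.
by rewrite powR_gt0// (lt_le_trans A0)//; case/andP: xAB.
Qed.

(** Split [(a + b) ^ p] as [a (a + b) ^ (p - 1) + b (a + b) ^ (p - 1)] and use, the exponent being
    negative, [a + b >= 2a] in the first summand and [a + b >= b] in the second. *)
Lemma powR_add_le p a b : p < 1 -> 0 < a -> a <= b ->
  (1 - 2 `^ (p - 1)) * a `^ p <= a `^ p + b `^ p - (a + b) `^ p.
Proof.
move=> p1 a0 ab; have b0 := lt_le_trans a0 ab.
have p10 : p - 1 <= 0 by lra.
rewrite (powR_split p (a + b)) ?addr_gt0// mulrDl.
have : b * (a + b) `^ (p - 1) <= b `^ p.
  by rewrite (powR_split p b)// ler_wpM2l ?(ltW b0)// ler_powR_neg// ler_wpDl// ltW.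
have : a * (a + b) `^ (p - 1) <= 2 `^ (p - 1) * a `^ p.
  rewrite (powR_split p a)// mulrCA -powRM ?(ltW a0)// ler_wpM2l ?(ltW a0)//.
  by rewrite ler_powR_neg// ?mulr_gt0//; lra.
by lra.
Qed.

(** The same splitting, with both comparisons reversed because the exponent [p - 1] is now
    positive. *)
Lemma powR_add_ge p a b : 1 < p -> 0 < a -> a <= b ->
  (2 `^ (p - 1) - 1) * a `^ p <= (a + b) `^ p - a `^ p - b `^ p.
Proof.
move=> p1 a0 ab; have b0 := lt_le_trans a0 ab.
have p10 : 0 <= p - 1 by lra.
rewrite (powR_split p (a + b)) ?addr_gt0// mulrDl.
have : b `^ p <= b * (a + b) `^ (p - 1).
  rewrite (powR_split p b)// ler_wpM2l ?(ltW b0)// ge0_ler_powR ?nnegrE//; lra.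
have : 2 `^ (p - 1) * a `^ p <= a * (a + b) `^ (p - 1).
  rewrite (powR_split p a)// mulrCA -powRM ?(ltW a0)// ler_wpM2l ?(ltW a0)//.
  by rewrite ge0_ler_powR// ?nnegrE; lra.
by lra.
Qed.

(** The power is strictly subadditive for [p < 1] and strictly superadditive for [p > 1]; on a
    compact range the defect stays away from 0. *)
Lemma powR_defect_bounds p A B : p != 1 -> 0 < A -> A <= B ->
  exists c C : R, [/\ 0 < c, 0 < C & forall x y, A <= x <= B -> A <= y <= B ->
    let D := if p < 1 then x `^ p + y `^ p - (x + y) `^ p
             else (x + y) `^ p - x `^ p - y `^ p in
    c <= D <= C].
Proof.
move=> p1 A0 AB; have B0 := lt_le_trans A0 AB.
(* The interval reaches [2 * B] in order to contain [x + y]. *)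
have [c [C [c0 C0 cC]]] : exists c C : R, [/\ 0 < c, 0 < C &
    forall x, A <= x <= 2 * B -> c <= x `^ p <= C].
  by apply: powR_bounds => //; lra.
(* The factor from the two preceding lemmas; [2 ^ (p - 1)] is below 1 for [p < 1] and above 1 for
   [p > 1]. *)
pose r : R := if p < 1 then 1 - 2 `^ (p - 1) else 2 `^ (p - 1) - 1.
have r0 : 0 < r.
  rewrite /r; case: ifPn => [lt1|]; rewrite subr_gt0.
    by rewrite -[ltRHS](powRr0 2) /powR gt_eqF// ltr_expR ltr_pM2r ?ln_gt0//; lra.
  rewrite -leNgt => ge1.
  by rewrite -[ltLHS](powRr0 2) /powR gt_eqF// ltr_expR ltr_pM2r ?ln_gt0//; lra.
exists (r * c), (C + C); split; [by rewrite mulr_gt0|by rewrite addr_gt0|].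
move=> x y; wlog xy : x y / x <= y => [hw|] xAB yAB.
  have [xy|/ltW yx] := leP x y; first exact: hw.
  have := hw _ _ yx yAB xAB; rewrite [y + x]addrC [y `^ p + _]addrC.
  by rewrite [_ - _ - x `^ p]addrAC.
have /andP[cx xC] : c <= x `^ p <= C by apply: cC; case/andP: xAB => ??; lra.
have /andP[cy yC] : c <= y `^ p <= C by apply: cC; case/andP: yAB => ??; lra.
have /andP[cz zC] : c <= (x + y) `^ p <= C.
  by apply: cC; case/andP: xAB => ??; case/andP: yAB => ??; lra.
have x0 : 0 < x by case/andP: xAB => ??; lra.
have rc : r * c <= r * x `^ p by rewrite ler_wpM2l// ltW.
rewrite /= /r in rc *; case: ifPn rc => [lt1|ge1] rc; apply/andP; split; try lra.
- exact: le_trans rc (powR_add_le _ _ _ lt1 x0 xy).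
- apply: le_trans rc (powR_add_ge _ _ _ _ x0 xy).
  by rewrite lt_neqAle eq_sym p1 leNgt.
Qed.

(** Rescaling by [T] reduces this to [v ^ r >= v ^ 3 >= 1 - 3 (1 - v)] on the unit interval: the
    constant 3 is the slope of the cube at 1, and [r = 2H + 1] is at most 3. *)
Lemma powR_increment_le r T y : 1 <= r -> r <= 3 -> 0 < T -> 0 <= y -> y <= T ->
  T `^ r - y `^ r <= 3 * T `^ (r - 1) * (T - y).
Proof.
move=> r1 r3 T0 y0 yT; pose v := y / T.
have yE : y = T * v by rewrite /v mulrCA divff ?mulr1 ?gt_eqF.
have v0 : 0 <= v by rewrite divr_ge0// ltW.
have v1 : v <= 1 by rewrite ler_pdivrMr// mul1r.
have v3 : 1 - 3 * (1 - v) <= v `^ r.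
  apply: (@le_trans _ _ (v ^+ 3)).
    rewrite -subr_ge0 (_ : _ - _ = (1 - v) ^+ 2 * (2 + v)); last by ring.
    by rewrite mulr_ge0 ?sqr_ge0//; lra.
  move: v0; rewrite le_eqVlt => /orP[/eqP<-|v0].
    by rewrite expr0n powR_ge0.
  by rewrite -(powR_mulrn 3 (ltW v0)); apply: ger_powR => //; rewrite v0 v1.
rewrite yE powRM ?(ltW T0)// (powR_split r T)//.
have := ler_wpM2l (mulr_ge0 (ltW T0) (powR_ge0 T (r - 1))) v3.
by lra.
Qed.

Lemma powR_increment_ge r T y : 1 <= r -> 0 < T -> 0 <= y -> y <= T ->
  T `^ (r - 1) * (T - y) <= T `^ r - y `^ r.
Proof.
move=> r1 T0 y0 yT.
have : y `^ r <= y * T `^ (r - 1).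
  move: y0; rewrite le_eqVlt => /orP[/eqP<-|y0].
    by rewrite powR0 ?mul0r//; lra.
  rewrite (powR_split r y)// ler_wpM2l ?(ltW y0)// ge0_ler_powR ?nnegrE//; lra.
by rewrite (powR_split r T)//; lra.
Qed.

End PowerBounds.

(** * Quadratic forms of the kernels at the prediction errors *)

Section Contrasts.
Context {R : realType}.
Variable k : R -> R -> R.

(* The quadratic form of the kernel [k] at [F t - (al * F s + be * F u)]. *)
Definition contrast (al be s t u : R) : R :=
  k t t + al ^+ 2 * k s s + be ^+ 2 * k u u - 2 * al * k s t - 2 * be * k t u
  + 2 * al * be * k s u.

End Contrasts.

Section KernelContrasts.
Context {R : realType}.
Variables (H s t u : R).
Hypotheses (H_gt0 : 0 < H) (s_ge0 : 0 <= s) (st : s < t) (tu : t < u).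
Let a := t - s.
Let b := u - t.
Let al := b / (u - s).
Let be := a / (u - s).

(** The interpolation error annihilates affine functions, so each kernel term that is constant in
    one of its variables drops out, and only the powers of distances survive. *)
Lemma fbm_contrast :
  contrast (fbm_kernel H) al be s t u / (al * a) =
  a `^ (2 * H - 1) + b `^ (2 * H - 1) - (a + b) `^ (2 * H - 1).
Proof.
have a0 : 0 < a by rewrite subr_gt0.
have b0 : 0 < b by rewrite subr_gt0.
rewrite /contrast /fbm_kernel !subrr normr0 (distrC s t) (distrC t u) (distrC s u).
rewrite powR0 ?gt_eqF ?mulr_gt0//.
have -> : u - s = a + b by rewrite /a /b; ring.
rewrite -/a -/b !(gtr0_norm a0) !(gtr0_norm b0) !(gtr0_norm (addr_gt0 a0 b0)).
(* With the powers of the distances lowered to exponent [2H - 1], the claim is rational in the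
   powers, which are then generalised to atoms. *)
rewrite (powR_split (2 * H) a)// (powR_split (2 * H) b)//.
rewrite (powR_split (2 * H) (a + b)) ?(addr_gt0 a0 b0)//.
rewrite /al /be (_ : u - s = a + b); last by rewrite /a /b; ring.
have ab0 : a + b != 0 by rewrite (lt0r_neq0 (addr_gt0 a0 b0)).
have an0 : a != 0 by rewrite lt0r_neq0.
have bn0 : b != 0 by rewrite lt0r_neq0.
move: (_ `^ _) (_ `^ _) (_ `^ _) (_ `^ _) (_ `^ _) (_ `^ _) => *.
by field; rewrite ab0 an0 bn0.
Qed.

(** As before: the terms dropping out are now constant or linear in one variable, and
    [|x - x'| ^ (2H + 2)] survives. *)
Lemma integrated_fbm_contrast :
  contrast (integrated_kernel (fbm_kernel H)) al be s t u / (al * a) =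
  ((a + b) `^ (2 * H + 1) - a `^ (2 * H + 1) - b `^ (2 * H + 1))
    / ((2 * H + 1) * (2 * H + 2)).
Proof.
have a0 : 0 < a by rewrite subr_gt0.
have b0 : 0 < b by rewrite subr_gt0.
have t0 : 0 <= t by apply: ltW; exact: le_lt_trans st.
have u0 : 0 <= u by apply: ltW; exact: le_lt_trans tu.
rewrite /contrast !integrated_fbm_kernelE//.
rewrite !subrr normr0 (distrC s t) (distrC t u) (distrC s u).
set q := 2 * H; have q0 : 0 < q by rewrite mulr_gt0.
rewrite powR0; last by rewrite gt_eqF// addr_gt0.
have usE : u - s = a + b by rewrite /a /b; ring.
rewrite usE -/a -/b !(gtr0_norm a0) !(gtr0_norm b0) !(gtr0_norm (addr_gt0 a0 b0)).
have q21 : q + 2 - 1 = q + 1 by ring.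
rewrite (powR_split (q + 2) a)// (powR_split (q + 2) b)//.
rewrite (powR_split (q + 2) (a + b)) ?(addr_gt0 a0 b0)// q21.
rewrite /al /be usE.
have ab0 : a + b != 0 by rewrite (lt0r_neq0 (addr_gt0 a0 b0)).
have an0 : a != 0 by rewrite lt0r_neq0.
have bn0 : b != 0 by rewrite lt0r_neq0.
have q1 : q + 1 != 0 by rewrite lt0r_neq0// addr_gt0.
have q2 : q + 2 != 0 by rewrite lt0r_neq0// addr_gt0.
(* The points also occur as polynomial factors, so they are expressed through [s], [a] and [b]. *)
have tE : t = s + a by rewrite /a; ring.
have uE : u = s + a + b by rewrite /a /b; ring.
rewrite tE uE.
move: (_ `^ _) (_ `^ _) (_ `^ _) (_ `^ _) (_ `^ _) (_ `^ _) (_ `^ _) (_ `^ _) (_ `^ _) => *.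
by field; rewrite ab0 an0 bn0 q1 q2.
Qed.

Lemma fbm_increment :
  contrast (fbm_kernel H) 1 0 s t u / a = a `^ (2 * H - 1).
Proof.
have a0 : 0 < a by rewrite subr_gt0.
rewrite /contrast /fbm_kernel !subrr normr0 (distrC s t) -/a (gtr0_norm a0).
rewrite powR0 ?gt_eqF ?mulr_gt0// (powR_split (2 * H) a)//.
by field; rewrite gt_eqF.
Qed.

(** A plain increment annihilates constants but not linear functions, so the kernel terms linear in
    one variable remain and give the difference of powers of [t] and [s]. *)
Lemma integrated_fbm_increment :
  contrast (integrated_kernel (fbm_kernel H)) 1 0 s t u / a =
  (t `^ (2 * H + 1) - s `^ (2 * H + 1)) / (2 * H + 1)
  - a `^ (2 * H + 1) / ((2 * H + 1) * (2 * H + 2)).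
Proof.
have a0 : 0 < a by rewrite subr_gt0.
have t0 : 0 <= t by apply: ltW; exact: le_lt_trans st.
rewrite /contrast expr0n/= !mulr0 !mul0r !integrated_fbm_kernelE//.
rewrite !subrr normr0 (distrC s t) -/a (gtr0_norm a0).
set q := 2 * H; have q0 : 0 < q by rewrite mulr_gt0.
rewrite powR0; last by rewrite gt_eqF// addr_gt0.
rewrite (powR_split (q + 2) a)// (_ : q + 2 - 1 = q + 1); last by ring.
have an0 : a != 0 by rewrite lt0r_neq0.
have q1 : q + 1 != 0 by rewrite lt0r_neq0// addr_gt0.
have q2 : q + 2 != 0 by rewrite lt0r_neq0// addr_gt0.
have tE : t = s + a by rewrite /a; ring.
rewrite tE.
move: (_ `^ _) (_ `^ _) (_ `^ _) (_ `^ _) (_ `^ _) => *.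
by field; rewrite an0 q1 q2.
Qed.

End KernelContrasts.

(** * Spacings of quasi-uniform partitions *)

Section Spacings.
Context {R : realType}.

(** All spacings of a partition agree up to the factor [C] and sum to [T]; comparing one spacing
    with each of the [N] summands gives [A = T / C] and [B = C * T]. *)
Lemma quasi_uniform_spacing (T : R) (x : nat -> nat -> R) : 0 < T ->
  (forall N, (0 < N)%N -> is_partition T N (x N)) -> quasi_uniform x ->
  exists A B : R, [/\ 0 < A, A <= B &
    forall N n, (n < N)%N -> A <= N%:R * spacing (x N) n <= B].
Proof.
move=> T0 xP [C C1 supC].
have C0 : 0 < C by exact: lt_le_trans C1.
have sp_gt0 N n : (n < N)%N -> 0 < spacing (x N) n.
  by move=> nN; have [_ xS _] := xP _ (leq_ltn_trans (leq0n n) nN); rewrite subr_gt0 xS.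
have sum_sp N : (0 < N)%N -> \sum_(i < N) spacing (x N) i = T.
  move=> N0; have [x0 _ xN] := xP _ N0.
  by rewrite -(big_mkord xpredT (spacing (x N))) telescope_sumr// xN x0 subr0.
have ratio N i j : (i < N)%N -> (j < N)%N -> spacing (x N) i <= C * spacing (x N) j.
  move=> iN jN; have N0 := leq_ltn_trans (leq0n i) iN.
  have min0 : 0 < min_spacing N (x N).
    by apply: lt_bigmin => [|k _]; apply: sp_gt0.
  have : max_spacing N (x N) / min_spacing N (x N) <= C.
    rewrite -lee_fin -supC; apply: ereal_sup_ubound; exists N => //.
  rewrite ler_pdivrMr// => maxmin.
  apply: le_trans (le_trans maxmin _).
    exact: (le_bigmax _ (fun k : 'I_N => spacing (x N) k) (Ordinal iN)).
  rewrite ler_pM2l//.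
  exact: (bigmin_le _ (Ordinal jN) (fun k : 'I_N => spacing (x N) k)).
exists (T / C), (C * T); split=> [||N n nN]; first exact: divr_gt0.
  rewrite ler_pdivrMr// -mulrAC ler_peMl ?(ltW T0)//.
  by rewrite -[leLHS]mulr1 ler_pM.
have N0 := leq_ltn_trans (leq0n n) nN.
have sumN (z : R) : N%:R * z = \sum_(i < N) z.
  by rewrite sumr_const card_ord mulr_natl.
rewrite ler_pdivrMr// mulrAC -mulrA sumN -{1}(sum_sp N N0) sumN -(sum_sp N N0).
rewrite mulr_sumr; apply/andP; split; apply: ler_sum => i _; last exact: ratio.
by rewrite ratio.
Qed.

End Spacings.

(** * The expected estimator as a sum of contrasts *)

Section ExpectedEstimator.
Context {R : realType} {d : measure_display} {Omega : measurableType d}.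
Variable P : probability Omega R.

(** Allows the process to be redefined at the origin, which is not a design point. *)
Lemma eq_cv_estimator (k : R -> R -> R) (N : nat) (x : 'I_N -> R) (g h : R -> R) :
  (forall n, g (x n) = h (x n)) -> cv_estimator k x g = cv_estimator k x h.
Proof.
move=> gh; congr (_ * _); apply: eq_bigr => n _.
rewrite gh /posterior_mean (_ : \col_i g _ = \col_i h (leave_out x n i))//.
by apply/colP => i; rewrite !mxE gh.
Qed.

(** The kernel vanishes whenever one argument is 0, so setting the process to 0 there preserves all
    second moments; the rest is linearity. *)
Lemma expectation_cv_estimator (T : R) (k : R -> R -> R) (f : R -> {RV P >-> R})
    (M : nat) (y : nat -> R) :
  gaussian_process `[0, T] (fun=> 0) k f -> is_partition T M.+1 y ->
  (forall t, 0 <= t -> k 0 t = 0 /\ k t 0 = 0) ->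
  'E_P[fun w => cv_estimator brownian_kernel (fun n : 'I_M.+1 => y n.+1)
                  (fun t => f t w)]%E =
  (M.+1%:R^-1 *
   (\sum_(n < M)
      contrast k (spacing y n.+1 / (y n.+2 - y n)) (spacing y n / (y n.+2 - y n))
          (y n) (y n.+1) (y n.+2)
        / (spacing y n.+1 / (y n.+2 - y n) * spacing y n)
    + contrast k 1 0 (y M) (y M.+1) (y M.+1) / spacing y M))%:E.
Proof.
move=> fGP yP k0; have ylt := partition_lt _ _ _ yP; have [y0 _ yT] := yP.
(* The Brownian kernel treats [f 0] as [0]; this agrees with [f] only almost surely. *)
pose F t w := if t == 0 then 0 else f t w.
have yI i : (i <= M.+1)%N -> 0 <= y i <= T.
  move=> iM; rewrite -y0 -yT; apply/andP; split.
    by move: iM; case: i => // i iM; rewrite ltW ?ylt ?iM.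
  by move: iM; rewrite leq_eqVlt => /orP[/eqP->//|iM]; rewrite ltW ?ylt ?iM/=.
have hF i j : (i <= M.+1)%N -> (j <= M.+1)%N ->
    has_mean P (fun w => F (y i) w * F (y j) w) (k (y i) (y j)).
  move=> /yI/andP[i0 iT] /yI/andP[j0 jT]; rewrite /F.
  have [->|_] := eqVneq (y i) 0.
    by apply: (has_mean_eq _ _ _ _ _ (has_mean0 P)) => [w|]; rewrite ?mul0r ?(k0 _ j0).1.
  have [->|_] := eqVneq (y j) 0.
    by apply: (has_mean_eq _ _ _ _ _ (has_mean0 P)) => [w|]; rewrite ?mulr0 ?(k0 _ i0).2.
  by apply: gaussian_process_has_mean fGP _ _; rewrite /= in_itv/= ?i0 ?j0.
suff [_] : has_mean P (fun w => cv_estimator brownian_kernel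
    (fun n : 'I_M.+1 => y n.+1) (F^~ w)) (M.+1%:R^-1 *
   (\sum_(n < M)
      contrast k (spacing y n.+1 / (y n.+2 - y n)) (spacing y n / (y n.+2 - y n))
          (y n) (y n.+1) (y n.+2)
        / (spacing y n.+1 / (y n.+2 - y n) * spacing y n)
    + contrast k 1 0 (y M) (y M.+1) (y M.+1) / spacing y M)).
  move=> <-; congr (expectation P _); apply/funext => w.
  by apply: eq_cv_estimator => n; rewrite /F ifF// gt_eqF// -y0 ylt//=.
have quot (Y : Omega -> R) (m v : R) :
    has_mean P Y m -> has_mean P (fun w => Y w / v) (m / v).
  move=> Ym; apply: (has_mean_eq _ _ _ _ _ (has_meanZ P v^-1 _ _ Ym)) => [w|];
    exact: mulrC.
pose al n := spacing y n.+1 / (y n.+2 - y n).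
pose be n := spacing y n / (y n.+2 - y n).
have inner (n : 'I_M) : has_mean P
    (fun w => (F (y n.+1) w - (al n * F (y n) w + be n * F (y n.+2) w)) ^+ 2
              / (al n * spacing y n))
    (contrast k (al n) (be n) (y n) (y n.+1) (y n.+2) / (al n * spacing y n)).
  have nM := ltn_ord n.
  by apply/quot/has_mean_sqr_contrast; apply: hF => //; lia.
have last : has_mean P
    (fun w => (F (y M.+1) w - F (y M) w) ^+ 2 / spacing y M)
    (contrast k 1 0 (y M) (y M.+1) (y M.+1) / spacing y M).
  (* [contrast] wants a third point; it gets weight 0 and is taken to be [y M.+1] again, since
     [y M.+2] may lie outside [[0, T]]. *)
  apply: quot; apply: (has_mean_eq _ (fun w =>
    (F (y M.+1) w - (1 * F (y M) w + 0 * F (y M.+1) w)) ^+ 2)); last by [].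
    by apply: has_mean_sqr_contrast; apply: hF.
  by move=> w; rewrite mul1r mul0r addr0.
apply: (has_mean_eq _ _ _ _ _ (has_meanZ P (M.+1%:R^-1) _ _
  (has_meanD P _ _ _ _ (has_mean_sum P _ _ _ inner) last))) => // w.
by rewrite (cv_estimator_brownian _ _ _ _ yP)// /F eqxx.
Qed.

End ExpectedEstimator.

(** * Two-sided bounds for the summands and for the expectation *)

Section Rates.
Context {R : realType}.

Lemma ifbm_kernel0 (l : nat) (H : R) : l = 0%N \/ l = 1%N -> 0 < H ->
  forall t, 0 <= t -> ifbm_kernel l H 0 t = 0 /\ ifbm_kernel l H t 0 = 0.
Proof.
move=> l01 H0 t t0; have q0 : 2 * H != 0 by rewrite lt0r_neq0// mulr_gt0.
case: l01 => ->; rewrite /ifbm_kernel/=.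
  by rewrite /fbm_kernel !subr0 sub0r normrN normr0 powR0//; split; ring.
rewrite !integrated_fbm_kernelE//.
have q1 : 2 * H + 1 != 0 by rewrite lt0r_neq0// addr_gt0// mulr_gt0.
have q2 : 2 * H + 2 != 0 by rewrite lt0r_neq0// addr_gt0// mulr_gt0.
rewrite !subr0 sub0r normrN ger0_norm// !powR0//; split.
  by field; rewrite q1 q2.
by field; rewrite q1 q2.
Qed.

Variables (T A B : R).
Hypotheses (T_gt0 : 0 < T) (A_gt0 : 0 < A) (AB : A <= B).

(** [A] and [B] are fixed independently of [M], which makes all later bounds uniform in the
    partition. *)
Definition partition_within (M : nat) (y : nat -> R) : Prop :=
  is_partition T M.+1 y /\
  forall n, (n < M.+1)%N -> A <= M.+1%:R * spacing y n <= B.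

Definition loo_term (k : R -> R -> R) (y : nat -> R) (n : nat) : R :=
  contrast k (spacing y n.+1 / (y n.+2 - y n)) (spacing y n / (y n.+2 - y n))
    (y n) (y n.+1) (y n.+2) / (spacing y n.+1 / (y n.+2 - y n) * spacing y n).

Definition last_term (k : R -> R -> R) (y : nat -> R) (M : nat) : R :=
  contrast k 1 0 (y M) (y M.+1) (y M.+1) / spacing y M.

Lemma partition_ge0 (M : nat) (y : nat -> R) (n : nat) :
  is_partition T M.+1 y -> (n <= M.+1)%N -> 0 <= y n.
Proof.
move=> yP; have [<- _ _] := yP; case: n => // n nM.
by rewrite ltW// (partition_lt _ _ _ yP).
Qed.

(** Homogeneity: spacings are written as [x * e] with [e = 1 / N] and [x] between [A] and [B], and
    the power of [e] factors out. *)
Let pow_scale (p e x y : R) : 0 < e -> 0 < x -> 0 < y ->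
  [/\ (x * e) `^ p = e `^ p * x `^ p, (y * e) `^ p = e `^ p * y `^ p
    & (x * e + y * e) `^ p = e `^ p * (x + y) `^ p].
Proof.
move=> e0 x0 y0; rewrite -mulrDl.
by split; rewrite powRM ?ltW ?addr_gt0// mulrC.
Qed.

Lemma loo_term_bounds (l : nat) (H : R) : l = 0%N \/ l = 1%N -> 0 < H -> H < 1 ->
  exists c C : R, [/\ 0 < c, 0 < C & forall M y n,
    partition_within M y -> (n < M)%N ->
    c * M.+1%:R^-1 `^ (2 * (l%:R + H) - 1) <= loo_term (ifbm_kernel l H) y n
      <= C * M.+1%:R^-1 `^ (2 * (l%:R + H) - 1)].
Proof.
move=> l01 H0 H1; set p := 2 * _ - 1.
(* The exponent 1 would force [H = 1] for [l = 0] and [H = 0] for [l = 1]. *)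
have p1 : p != 1.
  rewrite /p; case: l01 => ->; apply/eqP; first lra.
  by lra.
have [c [C [c0 C0 cC]]] := powR_defect_bounds p A B p1 A_gt0 AB.
have setup M y n : partition_within M y -> (n < M)%N ->
    exists x z : R, [/\ [/\ 0 < x, 0 < z, A <= x <= B & A <= z <= B],
      y n.+1 - y n = x * M.+1%:R^-1, y n.+2 - y n.+1 = z * M.+1%:R^-1,
      [/\ 0 <= y n, y n < y n.+1 & y n.+1 < y n.+2] & 0 < M.+1%:R^-1 :> R].
  move=> [yP ysp] nM; have [_ yS _] := yP.
  have N0 : 0 < M.+1%:R :> R by rewrite ltr0n.
  have n1 : (n < M.+1)%N by exact: ltnW.
  have n2 : (n.+1 < M.+1)%N by [].
  exists (M.+1%:R * spacing y n), (M.+1%:R * spacing y n.+1).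
  split; [split|..|split|].
  - by rewrite mulr_gt0// subr_gt0 yS.
  - by rewrite mulr_gt0// subr_gt0 yS.
  - exact: ysp.
  - exact: ysp.
  - by rewrite mulrAC divff ?mul1r// pnatr_eq0.
  - by rewrite mulrAC divff ?mul1r// pnatr_eq0.
  - by apply: (partition_ge0 M) => //; exact: ltnW.
  - exact: yS.
  - exact: yS.
  - by rewrite invr_gt0.
have [l0|l1] := l01.
  exists c, C; split=> // M y n yM nM.
  have [x [z [[x0 z0 xAB zAB] xE zE [y0 y1 y2] e0]]] := setup _ _ _ yM nM.
  rewrite l0 /loo_term/= fbm_contrast// xE zE.
  have pE : 2 * H - 1 = p by rewrite /p l0 add0r.
  have [-> -> ->] := pow_scale (2 * H - 1) _ _ _ e0 x0 z0.
  have := cC _ _ xAB zAB; rewrite ifT; last by rewrite -pE; lra.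
  rewrite pE -mulrDr -mulrBr ![_ * M.+1%:R^-1 `^ _]mulrC.
  by rewrite !ler_pM2l ?powR_gt0.
(* For [l = 1], [p * (p + 1)] is the denominator [(2H + 1) (2H + 2)] of the contrast. *)
have p2 : 0 < p * (p + 1) by rewrite /p l1 mulr_gt0//; lra.
exists (c / (p * (p + 1))), (C / (p * (p + 1))).
split=> [||M y n yM nM]; rewrite ?divr_gt0//.
have [x [z [[x0 z0 xAB zAB] xE zE [y0 y1 y2] e0]]] := setup _ _ _ yM nM.
rewrite l1 /loo_term/= integrated_fbm_contrast// xE zE.
have pE : 2 * H + 1 = p by rewrite /p l1; ring.
have -> : 2 * H + 2 = p + 1 by rewrite -pE; ring.
rewrite pE; have [-> -> ->] := pow_scale p _ _ _ e0 x0 z0.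
have := cC _ _ xAB zAB; rewrite ifF; last first.
  by apply/negbTE; rewrite -leNgt -pE lerDr ltW// mulr_gt0.
rewrite -!mulrBr ![_ / _ * M.+1%:R^-1 `^ _]mulrC ![_ `^ _ * (_ / _)]mulrA.
by rewrite !ler_pM2r ?invr_gt0// !ler_pM2l ?powR_gt0.
Qed.

Lemma last_term_fbm_bounds (H : R) : 0 < H ->
  exists c C : R, [/\ 0 < c, 0 < C & forall M y, partition_within M y ->
    c * M.+1%:R^-1 `^ (2 * H - 1) <= last_term (fbm_kernel H) y M
      <= C * M.+1%:R^-1 `^ (2 * H - 1)].
Proof.
move=> H0; have [c [C [c0 C0 cC]]] := powR_bounds A B (2 * H - 1) A_gt0 AB.
exists c, C; split=> // M y [yP ysp]; have [_ yS _] := yP.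
have N0 : 0 < M.+1%:R :> R by rewrite ltr0n.
have AsB := ysp _ (ltnSn M).
have x0 : 0 < M.+1%:R * spacing y M by rewrite mulr_gt0// subr_gt0 yS.
rewrite /last_term fbm_increment ?yS// -/(spacing y M).
have -> : spacing y M = M.+1%:R * spacing y M * M.+1%:R^-1.
  by rewrite mulrAC divff ?mul1r// pnatr_eq0.
rewrite (powRM _ (ltW x0)) ?invr_ge0 ?(ltW N0)//.
by rewrite !ler_pM2r ?powR_gt0 ?invr_gt0//; exact: cC.
Qed.

(** With [s] the last spacing, the difference of powers is of order [T ^ (r - 1) s]. The subtracted
    [s ^ r / (r (r + 1))] cannot cancel it, because [s <= T] bounds it by the fraction [1 / (r + 1)]
    of the lower estimate. *)
Lemma last_term_ifbm_bounds (H : R) : 0 < H -> H < 1 ->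
  exists c C : R, [/\ 0 < c, 0 < C & forall M y, partition_within M y ->
    c * M.+1%:R^-1 <= last_term (integrated_kernel (fbm_kernel H)) y M
      <= C * M.+1%:R^-1].
Proof.
move=> H0 H1; pose r := 2 * H + 1; pose K := T `^ (r - 1) / r.
have r0 : 0 < r by rewrite addr_gt0// mulr_gt0.
have K0 : 0 < K by rewrite divr_gt0// powR_gt0.
have Kr0 : 0 < K * (r / (r + 1)) by exact: mulr_gt0 K0 (divr_gt0 r0 (addr_gt0 r0 ltr01)).
have B0 := lt_le_trans A_gt0 AB.
(* [r / (r + 1)] is what is left after removing the fraction [1 / (r + 1)]; the 3 comes from
   [powR_increment_le]. *)
exists (K * (r / (r + 1)) * A), (3 * K * B).
split=> [||M y [yP ysp]].
- exact: mulr_gt0 Kr0 A_gt0.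
- exact: mulr_gt0 (mulr_gt0 (ltr0Sn R 2) K0) B0.
have [_ yS yT] := yP.
have N0 : 0 < M.+1%:R :> R by rewrite ltr0n.
have /andP[As sB] : A * M.+1%:R^-1 <= spacing y M <= B * M.+1%:R^-1.
  by rewrite ler_pdivrMr// ler_pdivlMr// [_ * M.+1%:R]mulrC; exact: ysp.
have s0 : 0 < spacing y M by rewrite subr_gt0 yS.
have yM0 : 0 <= y M by exact: (partition_ge0 M).
rewrite /last_term integrated_fbm_increment ?yS// -/r -/(spacing y M).
have -> : 2 * H + 2 = r + 1 by rewrite /r; ring.
have yMT : y M <= T by rewrite -yT ltW ?yS.
have sE : T - y M = spacing y M by rewrite /spacing yT.
have le_inc : T `^ r - y M `^ r <= 3 * T `^ (r - 1) * spacing y M.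
  by rewrite -sE; apply: powR_increment_le => //; rewrite /r; lra.
have ge_inc : T `^ (r - 1) * spacing y M <= T `^ r - y M `^ r.
  by rewrite -sE; apply: powR_increment_ge => //; rewrite /r; lra.
have s_pow : spacing y M `^ r <= T `^ (r - 1) * spacing y M.
  rewrite (powR_split r)// mulrC ler_wpM2r ?(ltW s0)//.
  apply: ge0_ler_powR; rewrite ?nnegrE ?(ltW s0) ?(ltW T_gt0)//.
    by rewrite /r; lra.
  by rewrite -sE gerBl.
rewrite yT; apply/andP; split.
  apply: (@le_trans _ _ (K * (r / (r + 1)) * spacing y M)).
    by rewrite -[leLHS]mulrA ler_pM2l.
  have -> : K * (r / (r + 1)) * spacing y M =
      T `^ (r - 1) * spacing y M / r - T `^ (r - 1) * spacing y M / (r * (r + 1)).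
    by rewrite /K; field; rewrite !lt0r_neq0// addr_gt0.
  by rewrite lerB// ler_pM2r ?invr_gt0// mulr_gt0// addr_gt0.
apply: (@le_trans _ _ ((T `^ r - y M `^ r) / r)).
  by rewrite gerBl divr_ge0 ?powR_ge0// mulr_ge0// ltW// addr_gt0.
apply: (@le_trans _ _ (3 * K * spacing y M)).
  rewrite (_ : 3 * K * _ = 3 * T `^ (r - 1) * spacing y M / r); last first.
    by rewrite /K; field; rewrite lt0r_neq0.
  by rewrite ler_pM2r ?invr_gt0.
by rewrite -[leRHS]mulrA ler_pM2l// mulr_gt0.
Qed.

(** With [e = 1 / (M + 1)] and [p = 2(l + H) - 1], the interior points contribute order [e ^ p]. For
    [l = 0] the last term has the order of the others; for [l = 1] it adds order [e ^ 2], and the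
    larger of the two decides. *)
Lemma cv_expectation_rate (l : nat) (H : R) : l = 0%N \/ l = 1%N -> 0 < H -> H < 1 ->
  let k := ifbm_kernel l H in
  exists c C : R, [/\ 0 < c, c <= C & forall M y, (0 < M)%N -> partition_within M y ->
    c * M.+1%:R^-1 `^ (Num.min (2 * (l%:R + H)) 3 - 1) <=
      M.+1%:R^-1 * (\sum_(n < M) loo_term k y n + last_term k y M)
      <= C * M.+1%:R^-1 `^ (Num.min (2 * (l%:R + H)) 3 - 1)].
Proof.
move=> l01 H0 H1 k; set m := _ - 1.
have [c1 [C1 [c10 C10 loo]]] := loo_term_bounds l H l01 H0 H1.
have sum_bounds M y : partition_within M y ->
    let q := M.+1%:R^-1 `^ (2 * (l%:R + H) - 1) in
    M%:R * (c1 * q) <= \sum_(n < M) loo_term k y n <= M%:R * (C1 * q).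
  move=> yM /=; have sumN (z : R) : M%:R * z = \sum_(n < M) z.
    by rewrite sumr_const card_ord mulr_natl.
  rewrite !sumN; apply/andP; split; apply: ler_sum => n _;
    by have /andP[] := loo _ _ _ yM (ltn_ord n).
have [l0|l1] := l01.
  have mE : m = 2 * (l%:R + H) - 1 by rewrite /m l0 min_l//; lra.
  have [c2 [C2 [c20 C20 last]]] := last_term_fbm_bounds H H0.
  (* Adding [c1] ensures that the lower constant is at most the upper one. *)
  exists (Num.min c1 c2), (Num.max C1 C2 + c1).
  split=> [||M y M0 yM]; first by rewrite lt_min c10.
    rewrite ge_min lerDr le_max (ltW C10)//.
  set e : R := M.+1%:R^-1; have e0 : 0 < e by rewrite invr_gt0.
  have := sum_bounds M y yM; rewrite /= -mE -/e; set q := e `^ m => /andP[lo hi].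
  have q0 : 0 < q by exact: powR_gt0.
  have /andP[lo' hi'] : c2 * q <= last_term k y M <= C2 * q.
    by rewrite /q mE /k l0 add0r; exact: last.
  (* [M] interior terms and the last one, all of order [q], are averaged over [M + 1] points. *)
  have eN (z : R) : z * q = e * (M%:R * (z * q) + z * q).
    rewrite -[X in _ + X]mul1r -mulrDl mulrA -[_ + 1]/(_ + 1%:R) -natrD addn1.
    by rewrite mulVf ?mul1r// pnatr_eq0.
  have [cle1 cle2] : Num.min c1 c2 <= c1 /\ Num.min c1 c2 <= c2.
    by rewrite !ge_min !lexx orbT.
  have [Cle1 Cle2] : C1 <= Num.max C1 C2 + c1 /\ C2 <= Num.max C1 C2 + c1.
    by split; rewrite ler_wpDr ?(ltW c10)// le_max lexx ?orbT.
  apply/andP; split.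
    rewrite eN ler_pM2l//; apply: lerD.
      by apply: le_trans lo; rewrite ler_wpM2l// ler_pM2r.
    by apply: le_trans lo'; rewrite ler_pM2r.
  rewrite [leRHS]eN ler_pM2l//; apply: lerD.
    by apply: (le_trans hi); rewrite ler_wpM2l// ler_pM2r.
  by apply: (le_trans hi'); rewrite ler_pM2r.
have [c2 [C2 [c20 C20 last]]] := last_term_ifbm_bounds H H0 H1.
pose p := 2 * (l%:R + H) - 1.
have mp : m <= p by rewrite /m /p lerD2r ge_min lexx.
have m2 : m <= 2.
  have : Num.min (2 * (l%:R + H)) 3 <= 3 by rewrite ge_min lexx orbT.
  by rewrite /m; lra.
(* The factor 1/2 is the lower bound of [M / (M + 1)], valid for [M > 0]. *)
exists (Num.min (c1 / 2) c2), (C1 + C2 + Num.min (c1 / 2) c2).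
have cmin0 : 0 < Num.min (c1 / 2) c2 by rewrite lt_min c20 divr_gt0.
split=> // [|M y M0 yM]; first by rewrite lerDr ltW// addr_gt0.
set e : R := M.+1%:R^-1; have e0 : 0 < e by rewrite invr_gt0.
have e1 : e <= 1 by rewrite invf_le1// ler1n.
have := sum_bounds M y yM; rewrite /= -/e -/p => /andP[lo hi].
have := last M y yM; rewrite -/e => /andP[lo' hi'].
have kE : integrated_kernel (fbm_kernel H) = k by rewrite /k l1.
rewrite kE in lo' hi'.
have ep0 : 0 < e `^ p by exact: powR_gt0.
have em0 : 0 < e `^ m by exact: powR_gt0.
have e2 : e `^ 2 = e * e by rewrite (powR_mulrn 2 (ltW e0)) expr2.
(* As [e <= 1], the smaller exponent [m] absorbs both [e ^ p] and [e ^ 2] in the upper bound. *)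
have epm : e `^ p <= e `^ m by apply: ger_powR => //; rewrite e0.
have e2m : e * e <= e `^ m by rewrite -e2; apply: ger_powR => //; rewrite e0.
have eM1 : e * M%:R <= 1.
  by rewrite mulrC ler_pdivrMr ?ltr0n// mul1r ler_nat.
have eM2 : 1 / 2 <= e * M%:R.
  have M1 : 1 <= M%:R :> R by rewrite ler1n.
  rewrite [e * _]mulrC ler_pdivlMr ?ltr0n// (_ : M.+1%:R = M%:R + 1); last by rewrite natr1.
  by lra.
have eMp : e * M%:R * e `^ p <= e `^ p by rewrite ger_pMl.
have eMp2 : 1 / 2 * e `^ p <= e * M%:R * e `^ p by rewrite ler_pM2r.
rewrite mulrDr.
have {}lo : c1 * (e * M%:R * e `^ p) <= e * \sum_(n < M) loo_term k y n.
  by rewrite (_ : c1 * _ = e * (M%:R * (c1 * e `^ p))) ?ler_pM2l//; ring.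
have {}hi : e * \sum_(n < M) loo_term k y n <= C1 * (e * M%:R * e `^ p).
  by rewrite (_ : C1 * _ = e * (M%:R * (C1 * e `^ p))) ?ler_pM2l//; ring.
have {}lo' : c2 * (e * e) <= e * last_term k y M.
  by rewrite [leLHS]mulrCA ler_pM2l.
have {}hi' : e * last_term k y M <= C2 * (e * e).
  by rewrite [leRHS]mulrCA ler_pM2l.
apply/andP; split.
  (* For the lower bound only the dominant contribution is kept: the interior one if [p <= 2], the
     last one otherwise. *)
  have [p2|p2] := leP p 2.
    have mE : m = p by rewrite /m /p min_l//; move: p2; rewrite /p; lra.
    apply: (@le_trans _ _ (c1 / 2 * e `^ p)).
      by rewrite mE ler_pM2r// ge_min lexx.
    apply: (@le_trans _ _ (c1 * (e * M%:R * e `^ p))).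
      by rewrite -mulrA ler_pM2l// -[2^-1]mul1r.
    apply: (le_trans lo); rewrite lerDl; apply: le_trans lo'.
    by rewrite !mulr_ge0// ltW.
  have mE : m = 2.
    rewrite /m min_r; first by ring.
    by move: p2; rewrite /p; lra.
  apply: (@le_trans _ _ (c2 * (e * e))).
    by rewrite mE e2 ler_pM2r ?mulr_gt0// ge_min lexx orbT.
  apply: (le_trans lo'); rewrite lerDr; apply: le_trans lo.
  by rewrite !mulr_ge0// ltW.
apply: (@le_trans _ _ (C1 * e `^ m + C2 * e `^ m)).
  apply: lerD; [apply: (le_trans hi)|apply: (le_trans hi')]; rewrite ler_pM2l//.
  exact: le_trans epm.
by rewrite -mulrDl ler_pM2r// lerDl ltW.
Qed.

End Rates.

(** * Rates along a quasi-uniform sequence of partitions *)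

Theorem theorem11 (R : realType) (d : measure_display)
    (Omega : measurableType d) (P : probability Omega R)
    (T : R) (x : nat -> nat -> R) (l : nat) (H : R)
    (f : R -> {RV P >-> R})
    (T_gt0 : 0 < T)
    (x_partition : forall N : nat, (0 < N)%N -> is_partition T N (x N))
    (x_quasi_uniform : quasi_uniform x)
    (l01 : l = 0%N \/ l = 1%N)
    (H_gt0 : 0 < H) (H_lt1 : H < 1)
    (f_GP : gaussian_process `[0, T] (fun=> 0) (ifbm_kernel l H) f) :
  let Esigma2 (N : nat) : \bar R :=
    ('E_P[fun w => cv_estimator brownian_kernel
                    (fun n : 'I_N => x N n.+1) (fun t => f t w)])%E in
  [/\ is_Theta Esigma2
        (fun N => N%:R `^ (1 - Num.min (2 * (l%:R + H)) 3)),
      l = 0%N -> is_Theta Esigma2 (fun N => N%:R `^ (1 - 2 * H)),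
      l = 1%N -> H < 1 / 2 -> is_Theta Esigma2 (fun N => N%:R `^ (- 1 - 2 * H))
    & l = 1%N -> 1 / 2 <= H -> is_Theta Esigma2 (fun N => N%:R `^ (- 2))].
Proof.
move=> Esigma2.
have [A [B [A0 AB spx]]] := quasi_uniform_spacing T x T_gt0 x_partition x_quasi_uniform.
have [c [C [c0 cC rate]]] := cv_expectation_rate T A B T_gt0 A0 AB l H l01 H_gt0 H_lt1.
have main : is_Theta Esigma2 (fun N => N%:R `^ (1 - Num.min (2 * (l%:R + H)) 3)).
  (* The rate requires at least one interior design point, hence [N >= 2], written [M.+2]. *)
  exists c, C; split=> //; exists 2%N => // -[|[|M]]// _.
  have yP := x_partition _ (ltn0Sn M.+1).
  rewrite /Esigma2 (expectation_cv_estimator P T _ _ M.+1 _ f_GP yP); last first.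
    exact: ifbm_kernel0.
  have := rate M.+1 (x M.+2) (ltn0Sn M) (conj yP (fun n => spx M.+2 n)).
  rewrite !lee_fin -powR_inv1// -powRrM mulN1r opprB => /andP[lo hi].
  by split.
split=> // [l0|l1 H2|l1 H2]; move: main.
- by rewrite (_ : Num.min _ _ = 2 * H)// l0 add0r min_l//; lra.
- rewrite (_ : 1 - Num.min _ _ = - 1 - 2 * H)// l1 min_l; first by ring.
  by lra.
- rewrite (_ : 1 - Num.min _ _ = - 2)// l1 min_r; first by ring.
  by lra.
Qed.
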